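(* Let $f=\sum_{i=0}^n a_ix^i\in\mathbb{Z}[x]$ with $n>0$, $a_n>0$, $a_0\neq0$ and $\gcd(a_0,\dots,a_n)=1$. If $f$ has no positive real roots, then $f\in\Phi_1$.
   Context: For $h\in\mathbb{Z}[x]$, $\mathrm{lt}(h)$ is the leading term and $h^+,h^-\in\mathbb{N}[x]$ are the positive and negative parts, $h=h^+-h^-$ with no monomial occurring in both. $\Phi_0=\{h\in\mathbb{Z}[x]\mid \mathrm{lt}(h)=h^+\}$ and $\Phi_1=\{h\in\mathbb{Z}[x]\mid hg\in\Phi_0\text{ for some monic }g\in\mathbb{Z}[x]\}$. *)

(* Defs.v *)
From mathcomp Require Import all_boot all_order all_algebra.
From mathcomp Require Import reals.

Set Implicit Arguments.
Unset Strict Implicit.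
Unset Printing Implicit Defensive.

Import Order.TTheory GRing.Theory Num.Theory.
Local Open Scope ring_scope.

(* The polynomials of N[x] are represented in {poly int}. *)
Definition pos_part (h : {poly int}) : {poly int} :=
  \poly_(i < size h) Num.max h`_i 0.

Definition neg_part (h : {poly int}) : {poly int} :=
  \poly_(i < size h) Num.max (- h`_i) 0.

Lemma coef_pos_part (h : {poly int}) (i : nat) :
  (pos_part h)`_i = Num.max h`_i 0.
Proof.
by rewrite coef_poly; case: ltnP => // hi; rewrite nth_default ?maxxx.
Qed.

Lemma coef_neg_part (h : {poly int}) (i : nat) :
  (neg_part h)`_i = Num.max (- h`_i) 0.
Proof.
by rewrite coef_poly; case: ltnP => // hi; rewrite nth_default ?oppr0 ?maxxx.
Qed.

Lemma pos_part_ge0 (h : {poly int}) (i : nat) : 0 <= (pos_part h)`_i.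
Proof. by rewrite coef_pos_part le_max lexx orbT. Qed.

Lemma neg_part_ge0 (h : {poly int}) (i : nat) : 0 <= (neg_part h)`_i.
Proof. by rewrite coef_neg_part le_max lexx orbT. Qed.

Lemma pos_neg_partE (h : {poly int}) : h = pos_part h - neg_part h.
Proof.
apply/polyP => i; rewrite coefB coef_pos_part coef_neg_part.
by case: (lerP h`_i 0) => hi; case: (lerP (- h`_i) 0) => hj;
  rewrite ?subr0 ?sub0r ?opprK //; apply/eqP; rewrite eq_le;
  move: hi hj; rewrite ?oppr_le0 ?oppr_gt0 => hi hj;
  rewrite ?hi ?hj //; case/andP: (lt_asym h`_i 0); rewrite hi hj.
Qed.

Lemma pos_neg_part_disjoint (h : {poly int}) (i : nat) :
  ((pos_part h)`_i == 0) || ((neg_part h)`_i == 0).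
Proof.
rewrite coef_pos_part coef_neg_part.
by case: (lerP h`_i 0) => hi; rewrite ?eqxx // orbC max_r ?eqxx ?oppr_le0 // ltW.
Qed.

(* Here lead_term 0 = 0, so that 0 belongs to Phi0. *)
Definition lead_term (h : {poly int}) : {poly int} :=
  lead_coef h *: 'X^((size h).-1).

Definition Phi0 (h : {poly int}) : Prop := lead_term h = pos_part h.

Definition Phi1 (h : {poly int}) : Prop :=
  exists2 g : {poly int}, g \is monic & Phi0 (h * g).

(* Main.v *)
(** A real polynomial [p] that is positive on [0, oo[ and has positive leading
    coefficient becomes coefficientwise positive after multiplication by a large
    power of [X + 1] (Poincare; the univariate case of Polya's theorem).  Up to a
    positive factor, the coefficient of [X^k] in [p (X + 1)^N] is
    [\sum_i p_i k^_i j^_(n - i)] with [j = N + n - k]; the falling factorials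
    differ from the powers by a relative error [O(1/N)], and the homogeneous form
    [\sum_i p_i k^i j^(n - i)] is at least [d (k + j)^n] for some [d > 0].
    If moreover [F = f (X + 1)^N] has positive integer coefficients [F_i], then
    [F (X - c)] has coefficients [F_(i-1) - c F_i <= 0] below its leading term
    as soon as the integer [c] bounds all the [F_i]. *)

Require Import Defs.
From mathcomp Require Import all_boot all_order all_algebra.
From mathcomp Require Import reals.
From mathcomp Require Import ring lra zify.
From mathcomp Require Import polyrcf.
From mathcomp Require Import topology normedtype derive.

Set Implicit Arguments.
Unset Strict Implicit.
Unset Printing Implicit Defensive.

Import Order.TTheory GRing.Theory Num.Theory.
Import numFieldNormedType.Exports.
Local Open Scope ring_scope.

Lemma poly_lower_bound (R : realType) (p : {poly R}) :
  (forall x, 0 <= x <= 1 -> 0 < p.[x]) ->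
  exists2 d, 0 < d & forall x, 0 <= x <= 1 -> d <= p.[x].
Proof.
move=> p_gt0.
have [] := EVT_min (f := horner p) (@ler01 R).
  exact: continuous_subspaceT (@continuous_horner _ p).
move=> c; rewrite in_itv /= => c01 minc.
by exists p.[c]; [exact: p_gt0 | move=> x x01; apply: minc; rewrite in_itv].
Qed.

(** * Falling factorials compared with powers *)

Lemma expn_leq2r (k M i : nat) : (k <= M)%N -> (k ^ i <= M ^ i)%N.
Proof. by case: i => // i; rewrite leq_exp2r. Qed.

Lemma ffact_leq_exp (k i : nat) : (k ^_ i <= k ^ i)%N.
Proof. by elim: i => // i IH; rewrite ffactnSr expnSr leq_mul // leq_subr. Qed.

(** Induction on [i]: replacing the new factor [k] by [k - i] costs at most [i * M ^ i.+1], and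
    [i ^ 2 + i <= i.+1 ^ 2]. Truncation is harmless, since only [k <= (k - i) + i] is used. *)
Lemma expn_ffact_bound (M k i : nat) : (k <= M)%N ->
  (M * k ^ i <= M * k ^_ i + i ^ 2 * M ^ i)%N.
Proof.
move=> kM; elim: i => [|i IH]; first by rewrite leq_addr.
have ffM : (k ^_ i <= M ^ i)%N.
  exact: leq_trans (ffact_leq_exp k i) (expn_leq2r i kM).
have ksub : (k <= (k - i) + i)%N by rewrite addnC -leq_subLR.
rewrite !expnSr ffactnSr; move: IH ffM ksub.
move: (k ^ i)%N (k ^_ i)%N (M ^ i)%N (k - i)%N => u v w t.
move=> IH ffM ksub.
have := leq_mul IH (leqnn k); have := leq_mul (leqnn (M * v)) ksub.
have := leq_mul (leq_mul ffM (leqnn M)) (leqnn i).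
have := leq_mul (leqnn (i ^ 2 * w)) kM.
rewrite !expnS expn0; lia.
Qed.

(** The two powers are exchanged one after the other, the factor left alone being bounded by a power
    of [M]. *)
Lemma expn2_ffact2_bound (M k j i l : nat) : (k <= M)%N -> (j <= M)%N ->
  (M * (k ^ i * j ^ l) <=
     M * (k ^_ i * j ^_ l) + (i ^ 2 + l ^ 2) * M ^ (i + l))%N.
Proof.
move=> kM jM; rewrite expnD.
have := expn_ffact_bound i kM; have := expn_ffact_bound l jM.
have := expn_leq2r l jM.
have := leq_trans (ffact_leq_exp k i) (expn_leq2r i kM).
move: (k ^ i)%N (k ^_ i)%N (M ^ i)%N => u v w.
move: (j ^ l)%N (j ^_ l)%N (M ^ l)%N => u' v' w'.
move=> vw u'w' H' H.
have := leq_mul H (leqnn u'); have := leq_mul (leqnn v) H'.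
have := leq_mul (leqnn (i ^ 2 * w)) u'w'.
have := leq_mul vw (leqnn (l ^ 2 * w')).
lia.
Qed.

Lemma dist_exp2_ffact2 (R : realDomainType) (M k j i l : nat) :
  (k <= M)%N -> (j <= M)%N ->
  M%:R * `|k%:R ^+ i * j%:R ^+ l - (k ^_ i * j ^_ l)%:R| <=
    (i ^ 2 + l ^ 2)%:R * M%:R ^+ (i + l) :> R.
Proof.
move=> kM jM; rewrite ger0_norm; last first.
  by rewrite -!natrX -natrM subr_ge0 ler_nat leq_mul // ffact_leq_exp.
rewrite mulrBr lerBlDl -!natrX -!natrM -natrD ler_nat.
exact: expn2_ffact2_bound.
Qed.

(** * Coefficients of [p * ('X + 1) ^+ N] *)

Lemma coef_XD1_exp (R : nzRingType) (N i : nat) :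
  (('X + 1 : {poly R}) ^+ N)`_i = 'C(N, i)%:R.
Proof.
rewrite exprD1n (_ : \sum_(_ < _) _ = \poly_(j < N.+1) 'C(N, j)%:R).
  by rewrite coef_poly; case: ltnP => // Ni; rewrite bin_small.
by rewrite poly_def; apply: eq_bigr => j _; rewrite scaler_nat.
Qed.

(** With [j = N + n - k], both sides are N! k! j! / ((k - i)! (N - (k - i))!), because
    [j - (n - i) = N - (k - i)]. Outside the range of the binomial, one of the two falling
    factorials vanishes. *)
Lemma bin_fact_ffact (N n k i : nat) : (i <= n)%N -> (k <= N + n)%N ->
  ((if (k < i)%N then 0 else 'C(N, k - i)) * (k`! * (N + n - k)`!) =
    N`! * (k ^_ i * (N + n - k) ^_ (n - i)))%N.
Proof.
move=> i_n kM; case: ltnP => [ki|ik].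
  by rewrite (ffact_small ki) !mul0n muln0.
have [Nki|kiN] := ltnP N (k - i).
  by rewrite bin_small // (@ffact_small (N + n - k)) ?muln0 //; lia.
rewrite -(bin_fact kiN) -(ffact_fact ik) -(@ffact_fact (N + n - k) (n - i)); last lia.
have -> : (N + n - k - (n - i) = N - (k - i))%N by lia.
by lia.
Qed.

Lemma coef_mul_XD1_exp (R : comNzRingType) (p : {poly R}) (N n k : nat) :
  (size p <= n.+1)%N -> (k <= N + n)%N ->
  (p * ('X + 1) ^+ N)`_k * (k`! * (N + n - k)`!)%:R =
    N`!%:R * \sum_(i < n.+1) p`_i * (k ^_ i * (N + n - k) ^_ (n - i))%:R.
Proof.
move=> sp kM.
have pE : p = \sum_(i < n.+1) p`_i *: 'X^i.
  rewrite -poly_def; apply/polyP => i; rewrite coef_poly.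
  by case: ltnP => // ni; rewrite nth_default // (leq_trans sp).
rewrite {1}pE mulr_suml coef_sum mulr_suml mulr_sumr; apply: eq_bigr => i _.
rewrite -scalerAl coefZ coefXnM coef_XD1_exp -mulrA [RHS]mulrCA -[in RHS]natrM.
rewrite -(bin_fact_ffact _ kM) -1?ltnS //.
by rewrite [in RHS]natrM; case: ifP.
Qed.

(** * Homogeneous forms on the positive quadrant *)

Lemma homogenization_horner (F : fieldType) (p : {poly F}) (n : nat) (a b : F) :
  (size p <= n.+1)%N -> b != 0 ->
  \sum_(i < n.+1) p`_i * (a ^+ i * b ^+ (n - i)) = b ^+ n * p.[a / b].
Proof.
move=> sp b0; rewrite (horner_coef_wide _ sp) mulr_sumr; apply: eq_bigr => i _.
have bnE : b ^+ n = b ^+ (n - i) * b ^+ i by rewrite -exprD subnK // -ltnS.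
by rewrite bnE expr_div_n; field; rewrite expf_neq0.
Qed.

Lemma homogenization_lower_bound_le (R : realType) (p : {poly R}) (n : nat) :
  (size p <= n.+1)%N -> (forall x, 0 <= x <= 1 -> 0 < p.[x]) ->
  exists2 d, 0 < d & forall a b : R, 0 <= a <= b -> 0 < b ->
    d * (a + b) ^+ n <= \sum_(i < n.+1) p`_i * (a ^+ i * b ^+ (n - i)).
Proof.
move=> sp /poly_lower_bound[d d_gt0 dP].
(* The form equals [b ^+ n * p.[a / b]], hence is at least [d * b ^+ n]; the factor [2 ^+ n] comes
   from [a + b <= 2 * b]. *)
exists (d / 2 ^+ n) => [|a b /andP[a_ge0 ab] b_gt0].
  by rewrite divr_gt0 // exprn_gt0.
rewrite homogenization_horner ?gt_eqF // mulrAC ler_pdivrMr ?exprn_gt0 //.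
rewrite mulrAC -exprMn mulrC; apply: ler_pM.
- by rewrite exprn_ge0 // addr_ge0 // ltW.
- exact: ltW.
- by apply: lerXn2r; rewrite ?nnegrE; lra.
- by apply: dP; rewrite divr_ge0 ?(ltW b_gt0) // ler_pdivrMr // mul1r.
Qed.

(** The half [b < a] reduces to the other one by reversing the coefficients, which swaps [a] and
    [b]. *)
Lemma homogenization_lower_bound (R : realType) (p : {poly R}) (n : nat) :
  (size p <= n.+1)%N -> 0 < p`_n -> (forall x, 0 <= x -> 0 < p.[x]) ->
  exists2 d, 0 < d & forall a b : R, 0 <= a -> 0 <= b -> 0 < a + b ->
    d * (a + b) ^+ n <= \sum_(i < n.+1) p`_i * (a ^+ i * b ^+ (n - i)).
Proof.
move=> sp pn p_gt0; pose q := \poly_(i < n.+1) p`_(n - i).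
have sq : (size q <= n.+1)%N by exact: size_poly.
have revE a b : \sum_(i < n.+1) q`_i * (b ^+ i * a ^+ (n - i)) =
                \sum_(i < n.+1) p`_i * (a ^+ i * b ^+ (n - i)).
  rewrite (reindex_inj rev_ord_inj) /=; apply: eq_bigr => i _.
  have i_n : (i <= n)%N by rewrite -ltnS.
  by rewrite coef_poly subSS ltnS leq_subr subKn // [b ^+ _ * _]mulrC.
have [x /andP[/p_gt0] //|d1 d1_gt0 d1P] := homogenization_lower_bound_le sp.
have [x /andP[x_ge0 _]|d2 d2_gt0 d2P] := homogenization_lower_bound_le sq.
  have [->|x0] := eqVneq x 0; first by rewrite horner_coef0 coef_poly subn0.
  have := homogenization_horner x sq (oner_neq0 R).
  rewrite revE homogenization_horner // expr1n mul1r divr1 => <-.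
  by rewrite mulr_gt0 ?exprn_gt0 ?p_gt0 ?divr_ge0 // lt_def x0.
exists (Num.min d1 d2) => [|a b a_ge0 b_ge0 ab_gt0]; first by rewrite lt_min d1_gt0.
have abn : 0 <= (a + b) ^+ n by rewrite exprn_ge0 // addr_ge0.
have [ab|ba] := leP a b.
  apply: le_trans (d1P a b _ _); [|by rewrite a_ge0|by lra].
  by rewrite ler_wpM2r // ge_min lexx.
rewrite -revE addrC in abn *.
apply: le_trans (d2P b a _ _); [|by rewrite b_ge0 ltW|by lra].
by rewrite ler_wpM2r // ge_min lexx orbT.
Qed.

(** * Positivity of the coefficients for large [N] *)

Lemma polya (R : realType) (p : {poly R}) (n : nat) :
  (size p <= n.+1)%N -> 0 < p`_n -> (forall x, 0 <= x -> 0 < p.[x]) ->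
  exists N, forall k, (k <= N + n)%N -> 0 < (p * ('X + 1) ^+ N)`_k.
Proof.
move=> sp pn p_gt0.
have [d d_gt0 dP] := homogenization_lower_bound sp pn p_gt0.
pose C := \sum_(i < n.+1) `|p`_i| * (i ^ 2 + (n - i) ^ 2)%:R.
have C_ge0 : 0 <= C by apply: sumr_ge0 => i _; rewrite mulr_ge0.
(* [C] bounds the total error of passing from falling factorials to powers, in units of M^(n-1) with
   [M = N + n]; this must stay below the main term [d * M%:R ^+ n]. *)
have [N CN] : exists N : nat, C < N%:R * d.
  exists (Num.bound (C / d)); rewrite -ltr_pdivrMr //.
  by apply: archi_boundP; rewrite divr_ge0 // ltW.
have N_gt0 : (0 < N)%N.
  by case: N CN => //; rewrite mul0r => /(le_lt_trans C_ge0); rewrite ltxx.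
exists N => k kM.
have fact_gt0R : 0 < (k`! * (N + n - k)`!)%:R :> R.
  by rewrite ltr0n muln_gt0 !fact_gt0.
rewrite -(pmulr_lgt0 _ fact_gt0R) coef_mul_XD1_exp // pmulr_rgt0 ?ltr0n ?fact_gt0 //.
set M := (N + n)%N in kM *; pose j := (M - k)%N; rewrite -/j.
have M_gt0 : 0 < M%:R :> R by rewrite ltr0n addn_gt0 N_gt0.
rewrite -(pmulr_rgt0 _ M_gt0).
pose T := \sum_(i < n.+1) p`_i * (k%:R ^+ i * j%:R ^+ (n - i)).
set S := \sum_(i < n.+1) _.
have kj : k%:R + j%:R = M%:R :> R by rewrite -natrD subnKC.
have T_ge : d * M%:R ^+ n <= T by rewrite -kj; apply: dP; rewrite ?kj.
have TS : M%:R * (T - S) <= C * M%:R ^+ n.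
  rewrite /T /S -sumrB mulr_sumr mulr_suml; apply: ler_sum => i _.
  rewrite -mulrBr mulrCA (le_trans (ler_norm _)) // normrM -mulrA ler_wpM2l //.
  rewrite normrM (ger0_norm (ltW M_gt0)).
  have MnE : M%:R ^+ n = M%:R ^+ (i + (n - i)) :> R by rewrite subnKC // -ltnS.
  by rewrite MnE; apply: dist_exp2_ffact2; rewrite ?leq_subr.
have MdC : C < M%:R * d.
  by apply: lt_le_trans CN _; rewrite ler_pM2r // ler_nat leq_addr.
have Mn : 0 < M%:R ^+ n :> R by rewrite exprn_gt0.
(* Altogether M S >= M T - C M^n >= (M d - C) M^n > 0. *)
have : C * M%:R ^+ n < M%:R * d * M%:R ^+ n by rewrite ltr_pM2r.
have : M%:R * (d * M%:R ^+ n) <= M%:R * T by rewrite ler_pM2l.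
by move: TS; rewrite mulrBr mulrA; lra.
Qed.

Lemma Phi0_mul_XsubC (F : {poly int}) :
  (forall i, (i < size F)%N -> 0 < F`_i) ->
  Phi0 (F * ('X - (\sum_(i < size F) F`_i)%:P)).
Proof.
move=> F_gt0; set c := \sum_(i < _) _.
have F_ge0 i : 0 <= F`_i.
  by have [/F_gt0/ltW //|/(nth_default 0) ->] := ltnP i (size F).
have [->|F0] := eqVneq F 0.
  rewrite mul0r /Phi0 /lead_term lead_coef0 scale0r.
  by apply/polyP => i; rewrite coef_pos_part coef0 maxxx.
have F_le_c i : F`_i <= c.
  have [iF|/(nth_default 0) ->] := ltnP i (size F); last exact: sumr_ge0.
  by rewrite /c (bigD1 (Ordinal iF)) //= lerDl sumr_ge0.
have sh : size (F * ('X - c%:P)) = (size F).+1.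
  by rewrite size_Mmonic ?monicXsubC // size_XsubC addn2.
rewrite /Phi0 /lead_term; apply/polyP => i.
rewrite coef_pos_part coefZ coefXn lead_coefE sh /=.
have [->|iF] := eqVneq i (size F).
  rewrite mulr1 max_l // -[X in _`_X]/((size F).+1.-1) -sh -lead_coefE.
  rewrite lead_coefM lead_coefXsubC mulr1 ltW // lead_coefE F_gt0 //.
  by rewrite ltn_predL size_poly_gt0.
rewrite mulr0; apply/esym/max_r.
rewrite mulrBr coefB coefMX coefMC subr_le0.
have c_ge0 : 0 <= c := le_trans (F_ge0 0%N) (F_le_c 0%N).
case: eqP => [_|/eqP i0]; first exact: mulr_ge0.
have [ltiF|geiF] := ltnP i (size F).
  (* Integrality enters here: a positive coefficient is at least 1, so F_(i-1) <= c <= F_i c. *)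
  by apply: le_trans (F_le_c _) _; rewrite ler_peMl // -gtz0_ge1 F_gt0.
have lt_Fi : (size F < i)%N by rewrite ltn_neqAle eq_sym iF.
by rewrite !nth_default ?mul0r // -ltnS prednK ?lt0n.
Qed.

(** Without roots on ]0, oo[ the sign there is the sign at infinity, that of the leading
    coefficient. A negative value at 0 would force a root in ]0, 1] by the intermediate value
    theorem. *)
Lemma horner_gt0_no_pos_root (R : rcfType) (p : {poly R}) :
  p`_0 != 0 -> 0 < lead_coef p -> (forall x, 0 < x -> ~~ root p x) ->
  forall x, 0 <= x -> 0 < p.[x].
Proof.
move=> p0_neq0 lead_gt0 noroot_p.
have pos x : 0 < x -> 0 < p.[x].
  move=> x_gt0; rewrite -sgr_gt0 (@sgp_pinftyP _ x p); first by rewrite sgr_gt0.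
    by move=> y; rewrite in_itv /= andbT => xy; apply/noroot_p/(lt_le_trans x_gt0).
  by rewrite in_itv /= lexx.
move=> x; rewrite le_eqVlt => /predU1P[<-|/pos//]; rewrite horner_coef0.
rewrite lt_def p0_neq0 /= leNgt; apply/negP => p0_lt0.
have [||y /andP[y_ge0 _] yroot] := @poly_ivt R p 0 1; first exact: ler01.
  by rewrite horner_coef0 !ltW ?pos.
have [y0|y_neq0] := eqVneq y 0; last first.
  by have := noroot_p y; rewrite yroot lt_def y_neq0 y_ge0 => /(_ isT).
by move: p0_neq0; rewrite -horner_coef0 -rootE -y0 yroot.
Qed.

Theorem lemma4p1 (R : realType) (n : nat) (a : 'I_n.+1 -> int) (f : {poly int})
  (f_def : f = \sum_(i < n.+1) a i *: 'X^i)
  (n_gt0 : (0 < n)%N)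
  (an_gt0 : 0 < a ord_max)
  (a0_neq0 : a ord0 != 0)
  (gcd_a : \big[gcdz/0]_(i < n.+1) a i = 1)
  (no_pos_root : forall x : R, 0 < x -> ~~ root (map_poly intr f) x) :
  Phi1 f.
Proof.
have fE : f = \poly_(i < n.+1) a (inord i).
  by rewrite f_def poly_def; apply: eq_bigr => i _; rewrite inord_val.
have coef_f (i : 'I_n.+1) : f`_i = a i.
  by rewrite fE coef_poly ltn_ord inord_val.
have sf : size f = n.+1.
  apply/anti_leq/andP; split; first by rewrite fE size_poly.
  rewrite ltnNge; apply: contraTN an_gt0 => /leq_sizeP/(_ n (leqnn n)) f_n.
  by rewrite -coef_f f_n.
pose p : {poly R} := map_poly intr f.
have sp : size p = n.+1 by rewrite size_map_inj_poly //; exact: intr_inj.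
have lead_p : 0 < lead_coef p.
  by rewrite lead_coefE sp coef_map ltr0z -[n]/(val (@ord_max n)) coef_f.
have p0 : p`_0 != 0 by rewrite coef_map intr_eq0 -[0%N]/(val (@ord0 n)) coef_f.
have pn : 0 < p`_n by rewrite -[n]/(n.+1.-1) -sp -lead_coefE.
have [|N NP] := polya _ pn (horner_gt0_no_pos_root p0 lead_p no_pos_root).
  by rewrite sp.
pose F := f * ('X + 1) ^+ N.
have F_gt0 i : (i < size F)%N -> 0 < F`_i.
  (* Positivity is checked in [R], where [F] becomes [p * ('X + 1) ^+ N]; its degree is at most
     [N + n], so [NP] reaches every coefficient. *)
  move=> iF; rewrite -(ltr0z R) -coef_map.
  rewrite rmorphM rmorphXn rmorphD rmorph1 /= map_polyX.
  apply: NP; rewrite -ltnS; apply: leq_trans iF _.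
  apply: leq_trans (size_polyMleq _ _) _; rewrite sf addSn /= addnC.
  apply: leq_trans (leq_add (size_poly_exp_leq _ _) (leqnn n)) _.
  by rewrite -polyC1 size_XaddC mul1n addSn.
exists (('X + 1) ^+ N * ('X - (\sum_(i < size F) F`_i)%:P)).
  by rewrite monicMr ?monicXsubC // monic_exp // -polyC1 monicXaddC.
by rewrite mulrA; exact: Phi0_mul_XsubC.
Qed.
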